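(* Let $n\ge 1$ be an integer and let $A_1A_2\cdots A_{4n+2}$ be an ideal $(4n+2)$-gon in the hyperbolic plane. For $i\in\{1,\dots,2n+1\}$, let $l_i$ be the common perpendicular to the pair of opposite sides $A_iA_{i+1}$ and $A_{i+2n+1}A_{i+2n+2}$ (indices of vertices modulo $4n+2$). If $l_1,\dots,l_{2n}$ are concurrent, then their common intersection point also belongs to $l_{2n+1}$.
   Context: The hyperbolic plane is taken in the Klein model: an open disk $\Delta$ bounded by a circle $\Gamma$, with the Hilbert distance $d(P,Q)=\frac12\log\left(\frac{BP}{BQ}\cdot\frac{AQ}{AP}\right)$, where $A,B$ are the intersection points of the line $PQ$ with $\Gamma$. Geodesics (hyperbolic lines) are the intersections of straight lines with $\Delta$. Points of $\Gamma$ are called ideal points. An ideal polygon $A_1\cdots A_{4n+2}$ is one whose vertices are distinct ideal points occurring in this cyclic order on $\Gamma$; its sides $A_iA_{i+1}$ are the hyperbolic lines with endpoints $A_i,A_{i+1}$. Opposite sides do not meet in $\Delta\cup\Gamma$, and two hyperbolic lines that do not meet in $\Delta\cup\Gamma$ have a unique common perpendicular, i.e. a unique hyperbolic line orthogonal (for the hyperbolic metric) to both. Lines are concurrent if they all pass through a common point of the hyperbolic plane. *)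

(* Defs.v *)
(* Stdlib reals with Coquelicot. The Euclidean plane is Coquelicot's C = R * R:
   Cmod (P - Q) is the Euclidean distance and t * u, for t real, is scaling. *)
From Stdlib Require Import Reals Lra Lia.
From Coquelicot Require Import Coquelicot.
Open Scope R_scope.

Definition dot (u v : C) : R := Re (u * Cconj v)%C.

Definition disk (c : C) (r : R) (P : C) : Prop := Cmod (P - c)%C < r.

Definition on_circle (c : C) (r : R) (P : C) : Prop := Cmod (P - c)%C = r.

(* The parameter s is the larger root of |P + s u - c|^2 = r^2; see
   exit_pointP. *)
Definition exit_param (c : C) (r : R) (P u : C) : R :=
  (- dot (P - c)%C u
   + sqrt (dot (P - c)%C u ^ 2 + Cmod u ^ 2 * (r ^ 2 - Cmod (P - c)%C ^ 2)))
  / Cmod u ^ 2.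

Definition exit_point (c : C) (r : R) (P u : C) : C :=
  (P + exit_param c r P u * u)%C.

(* B lies beyond Q as seen from P, and A beyond P as seen from Q, so that the
   logarithm is nonnegative. For P = Q the value is 0; see hdist_diag. *)
Definition hdist (c : C) (r : R) (P Q : C) : R :=
  let B := exit_point c r P (Q - P)%C in
  let A := exit_point c r P (P - Q)%C in
  / 2 * ln (Cmod (B - P)%C / Cmod (B - Q)%C * (Cmod (A - Q)%C / Cmod (A - P)%C)).

(* Length of the tangent vector u at P: the infinitesimal form of hdist; see
   hdist_lim. *)
Definition hnorm (c : C) (r : R) (P u : C) : R :=
  real (Lim (fun t : R => hdist c r P (P + t * u)%C / Rabs t) 0).

(* The Riemannian metric of hdist, recovered from hnorm by polarization. *)
Definition hinner (c : C) (r : R) (P u v : C) : R :=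
  (hnorm c r P (u + v)%C ^ 2 - hnorm c r P (u - v)%C ^ 2) / 4.

Definition on_line (P Q X : C) : Prop := exists t : R, X = (P + t * (Q - P))%C.

Definition hyperbolic_line (c : C) (r : R) (l : C -> Prop) : Prop :=
  exists P Q : C, disk c r P /\ disk c r Q /\ P <> Q /\
    forall X : C, l X <-> disk c r X /\ on_line P Q X.

(* The hyperbolic line whose endpoints are the distinct ideal points A, B. *)
Definition ideal_line (c : C) (r : R) (A B : C) : C -> Prop :=
  fun X => disk c r X /\ on_line A B X.

(* The nonzero vectors X - P and Y - P are the directions of l and m at P. *)
Definition orthogonal (c : C) (r : R) (l m : C -> Prop) : Prop :=
  exists P : C, l P /\ m P /\
    forall X Y : C, l X -> m Y -> hinner c r P (X - P)%C (Y - P)%C = 0.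

Definition common_perpendicular (c : C) (r : R) (s s' l : C -> Prop) : Prop :=
  hyperbolic_line c r l /\ orthogonal c r l s /\ orthogonal c r l s'.

(* The vertices are A 1, ..., A m, extended m-periodically to all indices. The
   cyclic order is that of a polar angle theta running once around the circle,
   in either direction. *)
Definition ideal_polygon (c : C) (r : R) (m : nat) (A : nat -> C) : Prop :=
  (forall k : nat, A (k + m)%nat = A k) /\
  exists theta : nat -> R,
    (forall k : nat, (1 <= k <= m)%nat ->
       A k = (c + r * (cos (theta k), sin (theta k)))%C) /\
    ((forall j k : nat, (1 <= j < k)%nat -> (k <= m)%nat -> theta j < theta k) \/
     (forall j k : nat, (1 <= j < k)%nat -> (k <= m)%nat -> theta k < theta j)) /\
    Rabs (theta m - theta 1%nat) < 2 * PI.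

Lemma Cmod_sqr (u : C) : Cmod u ^ 2 = fst u ^ 2 + snd u ^ 2.
Proof.
unfold Cmod. apply pow2_sqrt.
pose proof (pow2_ge_0 (fst u)). pose proof (pow2_ge_0 (snd u)). lra.
Qed.

Lemma Cmod_scal (s : R) (u : C) : Cmod (s * u)%C = Rabs s * Cmod u.
Proof. now rewrite Cmod_mult, Cmod_R. Qed.

Lemma disk_sqr (c : C) (r : R) (P : C) : disk c r P -> Cmod (P - c)%C ^ 2 < r ^ 2.
Proof. unfold disk. intros H. pose proof (Cmod_ge_0 (P - c)%C). nra. Qed.

Lemma Cmod_line (c P u : C) (s : R) :
  Cmod (P + s * u - c)%C ^ 2
  = Cmod (P - c)%C ^ 2 + 2 * s * dot (P - c)%C u + s ^ 2 * Cmod u ^ 2.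
Proof.
rewrite !Cmod_sqr. destruct P, c, u; unfold dot; simpl. ring.
Qed.

Lemma exit_param_spec (c : C) (r : R) (P u : C) : disk c r P -> u <> RtoC 0 ->
  0 < exit_param c r P u /\ on_circle c r (exit_point c r P u).
Proof.
intros HP Hu.
pose proof (disk_sqr _ _ _ HP) as HP2.
assert (Hm : 0 < Cmod u) by exact (proj1 (Cmod_gt_0 u) Hu).
assert (Hr : 0 < r) by (unfold disk in HP; pose proof (Cmod_ge_0 (P - c)%C); lra).
pose proof (Cmod_line c P u (exit_param c r P u)) as HL.
unfold on_circle, exit_point. unfold exit_param in HL |- *.
set (b := dot (P - c)%C u) in *. set (m := Cmod u) in *.
set (k := r ^ 2 - Cmod (P - c)%C ^ 2) in *.
assert (Hk : 0 < m ^ 2 * k) by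
  (unfold k; apply Rmult_lt_0_compat; [now apply pow_lt | lra]).
set (D := sqrt (b ^ 2 + m ^ 2 * k)) in *.
assert (HD : D ^ 2 = b ^ 2 + m ^ 2 * k) by (unfold D; apply pow2_sqrt; pose proof (pow2_ge_0 b); lra).
assert (HD0 : 0 <= D) by apply sqrt_pos.
assert (HbD : b < D) by
  (apply Rnot_le_lt; intros Hle;
   assert (0 <= (b - D) * (b + D)) by (apply Rmult_le_pos; lra); lra).
split.
- apply Rdiv_lt_0_compat; [lra | now apply pow_lt].
- apply Rsqr_inj; [apply Cmod_ge_0 | lra |].
  rewrite !Rsqr_pow2, HL.
  apply Rplus_eq_reg_r with (- Cmod (P - c)%C ^ 2).
  replace (r ^ 2 + - Cmod (P - c)%C ^ 2) with k by (unfold k; ring).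
  transitivity ((D ^ 2 - b ^ 2) / m ^ 2); [field; lra | rewrite HD; field; lra].
Qed.

Lemma exit_pointP (c : C) (r : R) (P u X : C) : disk c r P -> u <> RtoC 0 ->
  X = exit_point c r P u <->
  on_circle c r X /\ exists s : R, 0 < s /\ X = (P + s * u)%C.
Proof.
intros HP Hu. destruct (exit_param_spec c r P u HP Hu) as [H1 H2]. split.
- intros ->. split; [assumption | now exists (exit_param c r P u)].
- intros [HX [s [Hs ->]]]. unfold exit_point.
  unfold on_circle, exit_point in *.
  pose proof (Cmod_line c P u s) as E1.
  pose proof (Cmod_line c P u (exit_param c r P u)) as E2.
  rewrite HX in E1. rewrite H2 in E2.
  pose proof (disk_sqr _ _ _ HP). pose proof (proj1 (Cmod_gt_0 u) Hu) as Hm.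
  set (e := exit_param c r P u) in *. set (m := Cmod u) in *.
  set (b := dot _ _) in *. set (w := Cmod (P - c)%C) in *.
  assert (Hz : (s - e) * (s * e * m ^ 2 + (r ^ 2 - w ^ 2)) = 0).
  { assert (G1 : r ^ 2 - w ^ 2 = 2 * s * b + s ^ 2 * m ^ 2) by lra.
    assert (G2 : r ^ 2 - w ^ 2 = 2 * e * b + e ^ 2 * m ^ 2) by lra.
    transitivity (s * (r ^ 2 - w ^ 2) - e * (r ^ 2 - w ^ 2)
                  + s * e * m ^ 2 * (s - e)); [ring |].
    rewrite G2 at 1. rewrite G1. ring. }
  assert (0 < s * e * m ^ 2) by
    (apply Rmult_lt_0_compat; [now apply Rmult_lt_0_compat | now apply pow_lt]).
  apply Rmult_integral in Hz. replace s with e by lra. reflexivity.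
Qed.

Lemma hdist_diag (c : C) (r : R) (P : C) : hdist c r P P = 0.
Proof.
unfold hdist, exit_point. cbv zeta.
replace (P - P)%C with (RtoC 0) by (symmetry; apply Cplus_opp_r).
rewrite !Cmult_0_r, !Cplus_0_r.
replace (P - P)%C with (RtoC 0) by (symmetry; apply Cplus_opp_r). rewrite Cmod_0.
unfold Rdiv. rewrite !Rmult_0_l.
unfold ln. destruct (Rlt_dec 0 0); [exfalso |]; lra.
Qed.

Lemma Copp_opp (u : C) : (- - u)%C = u.
Proof. ring. Qed.

Lemma exit_point_scal (c : C) (r : R) (P u : C) (k : R) :
  disk c r P -> u <> RtoC 0 -> 0 < k ->
  exit_point c r P (k * u)%C = exit_point c r P u.
Proof.
intros HP Hu Hk. symmetry.
assert (Hk' : RtoC k <> RtoC 0) by (intros E; apply RtoC_inj in E; lra).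
apply exit_pointP; [exact HP | exact (Cmult_neq_0 _ _ Hk' Hu) |].
destruct (exit_param_spec c r P u HP Hu) as [H1 H2]. split; [assumption |].
exists (exit_param c r P u / k). split; [now apply Rdiv_lt_0_compat |].
unfold exit_point. rewrite RtoC_div by lra. field. exact Hk'.
Qed.

Lemma hdist_ray (c : C) (r : R) (P u : C) (t : R) :
  disk c r P -> u <> RtoC 0 -> 0 < t -> t < exit_param c r P u ->
  hdist c r P (P + t * u)%C =
  / 2 * ln (exit_param c r P u / (exit_param c r P u - t)
            * ((exit_param c r P (- u)%C + t) / exit_param c r P (- u)%C)).
Proof.
intros HP Hu Ht Htp.
assert (Hu' : (- u)%C <> RtoC 0) by
  (intros E; apply Hu; rewrite <- (Copp_opp u), E; ring).
destruct (exit_param_spec c r P u HP Hu) as [Hp _].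
destruct (exit_param_spec c r P (- u)%C HP Hu') as [Hq _].
pose proof (proj1 (Cmod_gt_0 u) Hu) as Hm.
unfold hdist. cbv zeta.
replace (P + t * u - P)%C with (t * u)%C by ring.
replace (P - (P + t * u))%C with (t * - u)%C by ring.
rewrite !exit_point_scal by assumption. unfold exit_point.
set (p := exit_param c r P u) in *. set (q := exit_param c r P (- u)%C) in *.
replace (P + p * u - P)%C with (p * u)%C by ring.
replace (P + q * - u - P)%C with (RtoC (- q) * u)%C by (rewrite RtoC_opp; ring).
replace (P + p * u - (P + t * u))%C with (RtoC (p - t) * u)%C
  by (rewrite RtoC_minus; ring).
replace (P + q * - u - (P + t * u))%C with (RtoC (- (q + t)) * u)%C
  by (rewrite RtoC_opp, RtoC_plus; ring).
rewrite !Cmod_scal, !Rabs_Ropp, !Rabs_pos_eq by lra.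
f_equal. f_equal. field. lra.
Qed.

Lemma hdist_lim (c : C) (r : R) (P u : C) : disk c r P -> u <> RtoC 0 ->
  is_lim (fun t : R => hdist c r P (P + t * u)%C / Rabs t) 0
    (sqrt (dot (P - c)%C u ^ 2 + Cmod u ^ 2 * (r ^ 2 - Cmod (P - c)%C ^ 2))
     / (r ^ 2 - Cmod (P - c)%C ^ 2)).
Proof.
intros HP Hu.
assert (Hu' : (- u)%C <> RtoC 0) by
  (intros E; apply Hu; rewrite <- (Copp_opp u), E; ring).
destruct (exit_param_spec c r P u HP Hu) as [Hp _].
destruct (exit_param_spec c r P (- u)%C HP Hu') as [Hq _].
pose proof (proj1 (Cmod_gt_0 u) Hu) as Hm.
pose proof (disk_sqr _ _ _ HP) as HP2.
set (V := _ / _).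
assert (HV : / 2 * (/ exit_param c r P u + / exit_param c r P (- u)%C) = V).
{ revert Hp Hq. unfold V, exit_param.
  replace (dot (P - c)%C (- u)%C) with (- dot (P - c)%C u)
    by (destruct P, c, u; unfold dot; simpl; ring).
  rewrite Cmod_opp.
  set (b := dot (P - c)%C u). set (m := Cmod u) in *.
  replace ((- b) ^ 2) with (b ^ 2) by ring.
  set (k := r ^ 2 - Cmod (P - c)%C ^ 2) in *.
  set (D := sqrt (b ^ 2 + m ^ 2 * k)). intros Hp Hq.
  assert (Hk : 0 < k) by (unfold k; lra).
  assert (HD : D ^ 2 = b ^ 2 + m ^ 2 * k) by
    (unfold D; apply pow2_sqrt; pose proof (pow2_ge_0 b);
     pose proof (Rmult_le_pos _ k (pow2_ge_0 m)); lra).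
  assert (Hm2 : 0 < m ^ 2) by now apply pow_lt.
  assert (H1 : - b + D <> 0) by
    (intros E; rewrite E in Hp; unfold Rdiv in Hp; lra).
  assert (H2 : b + D <> 0) by
    (intros E; rewrite Ropp_involutive, E in Hq; unfold Rdiv in Hq; lra).
  rewrite Ropp_involutive.
  transitivity (D * m ^ 2 / (D ^ 2 - b ^ 2)).
  - field. repeat split; try lra.
    replace (D ^ 2 - b ^ 2) with ((- b + D) * (b + D)) by ring.
    now apply Rmult_integral_contrapositive.
  - rewrite HD. field. repeat split; nra. }
pose proof (hdist_ray c r P u) as R1.
pose proof (hdist_ray c r P (- u)%C) as R2.
rewrite Copp_opp in R2.
set (p := exit_param c r P u) in *. set (q := exit_param c r P (- u)%C) in *.
set (f := fun t => / 2 * ln (p / (p - t) * ((q + t) / q))).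
assert (Hd : is_derive f 0 V).
{ unfold f. auto_derive.
  - rewrite Rplus_0_r, Ropp_0, Rplus_0_r. repeat split; try lra.
    replace (p * / p * (q * / q)) with 1 by (field; lra). lra.
  - rewrite <- HV. field. lra. }
apply is_derive_Reals in Hd.
apply is_lim_spec. intros eps.
destruct (Hd eps (cond_pos eps)) as [d Hdel].
assert (Hmin : 0 < Rmin d (Rmin p q)) by
  (repeat apply Rmin_glb_lt; auto; apply cond_pos).
exists (mkposreal _ Hmin). intros t Ht Ht0.
change (Rabs (t - 0) < Rmin d (Rmin p q)) in Ht.
rewrite Rminus_0_r in Ht.
pose proof (Rmin_l d (Rmin p q)). pose proof (Rmin_r d (Rmin p q)).
pose proof (Rmin_l p q). pose proof (Rmin_r p q).
assert (Hf0 : f 0 = 0).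
{ unfold f. replace (p / (p - 0) * ((q + 0) / q)) with 1 by (field; lra).
  rewrite ln_1. ring. }
specialize (Hdel t Ht0 ltac:(lra)).
rewrite Rplus_0_l, Hf0, Rminus_0_r in Hdel.
replace (hdist c r P (P + t * u)%C / Rabs t) with (f t / t); [exact Hdel |].
destruct (Rtotal_order t 0) as [Hn | [E | Hpos]]; [| easy |].
- rewrite (Rabs_left t) in Ht |- * by assumption.
  replace (P + t * u)%C with (P + RtoC (- t) * - u)%C by (rewrite RtoC_opp; ring).
  rewrite R2 by (auto; lra). unfold f.
  replace (q / (q - - t) * ((p + - t) / p))
    with (/ (p / (p - t) * ((q + t) / q))) by (field; lra).
  rewrite ln_Rinv; [field; lra |].
  apply Rmult_lt_0_compat; apply Rdiv_lt_0_compat; lra.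
- rewrite (Rabs_pos_eq t) in Ht |- * by lra.
  rewrite R1 by (auto; lra). reflexivity.
Qed.

(* Main.v *)
(* Let [off i] be the signed distance (up to a monotone change) from P to the main
   diagonal directed from A_i to A_(i+2n+1). The common perpendicular l_i is the
   bisector of the diagonals i and i + 1 that crosses the side A_i A_(i+1), hence
   P lies on l_i exactly when off (i + 1) = - off i. The first 2n concurrences
   give off (2n + 1) = off 1. The diagonal 2n + 2 is the diagonal 1 reversed, so
   off (2n + 2) = - off 1 = - off (2n + 1), which puts P on l_(2n+1). *)
Require Import Defs.
From Stdlib Require Import Reals Lra Lia.
From Coquelicot Require Import Coquelicot.
Open Scope R_scope.

(** * Closed form of the metric *)

Lemma hnorm_sqr (c : C) (r : R) (P u : C) : disk c r P ->
  hnorm c r P u ^ 2 =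
  (dot (P - c)%C u ^ 2 + Cmod u ^ 2 * (r ^ 2 - Cmod (P - c)%C ^ 2))
  / (r ^ 2 - Cmod (P - c)%C ^ 2) ^ 2.
Proof.
intros HP. pose proof (disk_sqr _ _ _ HP) as HP2.
(* [hdist_lim] excludes [u = 0], where the quotient is constantly 0, even at [t = 0] since
   [0 / 0 = 0]. *)
destruct (Ceq_dec u (RtoC 0)) as [-> | Hu].
- unfold hnorm.
  rewrite (Lim_ext (fun _ => 0)), Lim_const, Cmod_0.
  + destruct P, c; unfold dot; simpl. field. simpl in HP2. lra.
  + intros t. rewrite Cmult_0_r, Cplus_0_r, hdist_diag. unfold Rdiv. ring.
- unfold hnorm. rewrite (is_lim_unique _ _ _ (hdist_lim c r P u HP Hu)).
  cbn [real]. unfold Rdiv. rewrite Rpow_mult_distr, pow2_sqrt, pow_inv.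
  + reflexivity.
  + pose proof (pow2_ge_0 (dot (P - c)%C u)). pose proof (pow2_ge_0 (Cmod u)).
    nra.
Qed.

(** By [hnorm_sqr] the squared norm is a quadratic form in [u]; polarization yields the
    Beltrami-Klein metric tensor. *)
Lemma hinnerE (c : C) (r : R) (P u v : C) : disk c r P ->
  hinner c r P u v =
  (dot (P - c)%C u * dot (P - c)%C v + dot u v * (r ^ 2 - Cmod (P - c)%C ^ 2))
  / (r ^ 2 - Cmod (P - c)%C ^ 2) ^ 2.
Proof.
intros HP. pose proof (disk_sqr _ _ _ HP) as HP2.
unfold hinner. rewrite !hnorm_sqr by assumption. rewrite !Cmod_sqr in *.
destruct P, c, u, v; unfold dot; simpl in *. field. lra.
Qed.

(** * Chords and poles in half-angle coordinates *)

(** On half-angle vectors this is the sine of half the difference of the polar angles, which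
    vanishes only for equal ideal points. *)
Definition det2 (a b : C) : R := fst a * snd b - snd a * fst b.

(* With [a] and [b] the unit vectors at half the polar angles of two ideal
   points, these are the homogeneous coordinates, centred at [c], of the pole of
   their chord; for [b = a] they give the ideal point itself. *)
Definition pole1 (r : R) (a b : C) : R := r * (fst a * fst b - snd a * snd b).
Definition pole2 (r : R) (a b : C) : R := r * (fst a * snd b + snd a * fst b).
Definition pole3 (a b : C) : R := fst a * fst b + snd a * snd b.

Definition det3 (x1 x2 x3 y1 y2 y3 z1 z2 z3 : R) : R :=
  x1 * (y2 * z3 - y3 * z2) + x2 * (y3 * z1 - y1 * z3) + x3 * (y1 * z2 - y2 * z1).

Definition unit2 (a : C) : Prop := fst a ^ 2 + snd a ^ 2 = 1.

Definition ideal_point (c : C) (r : R) (a : C) : C :=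
  (fst c + pole1 r a a, snd c + pole2 r a a).

(** The third point is homogeneous because the pole of a diameter lies at infinity ([z = 0]). *)
Definition collinear (c U V : C) (x y z : R) : Prop :=
  det3 (fst U - fst c) (snd U - snd c) 1 (fst V - fst c) (snd V - snd c) 1 x y z
  = 0.

Lemma on_line_collinear (c U V X : C) : U <> V ->
  on_line U V X <-> collinear c U V (fst X - fst c) (snd X - snd c) 1.
Proof.
intros HUV. unfold on_line, collinear, det3.
destruct c as [c1 c2], U as [u1 u2], V as [v1 v2], X as [x1 x2]; cbn [fst snd].
split.
- intros [t E]. apply (f_equal (fun z => (fst z, snd z))) in E.
  simpl in E. injection E as -> ->. ring.
- intros E.
  assert (Hd : 0 < (v1 - u1) ^ 2 + (v2 - u2) ^ 2).
  { destruct (Req_dec v1 u1) as [-> |]; [destruct (Req_dec v2 u2) as [-> |] |].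
    - now elim HUV.
    - pose proof (pow2_gt_0 (v2 - u2)). nra.
    - pose proof (pow2_gt_0 (v1 - u1)). pose proof (pow2_ge_0 (v2 - u2)). nra. }
  (* Parameter of the orthogonal projection of [X]; it avoids dividing by a coordinate difference
     that may vanish. *)
  exists (((x1 - u1) * (v1 - u1) + (x2 - u2) * (v2 - u2))
          / ((v1 - u1) ^ 2 + (v2 - u2) ^ 2)).
  assert (E' : (x1 - u1) * (v2 - u2) - (x2 - u2) * (v1 - u1) = 0) by lra.
  unfold Cplus, Cmult; simpl. f_equal; apply Rminus_diag_uniq.
  + transitivity ((v2 - u2) * ((x1 - u1) * (v2 - u2) - (x2 - u2) * (v1 - u1))
                  / ((v1 - u1) ^ 2 + (v2 - u2) ^ 2)); [field; lra |].
    rewrite E'. unfold Rdiv. ring.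
  + transitivity (- (v1 - u1) * ((x1 - u1) * (v2 - u2) - (x2 - u2) * (v1 - u1))
                  / ((v1 - u1) ^ 2 + (v2 - u2) ^ 2)); [field; lra |].
    rewrite E'. unfold Rdiv. ring.
Qed.

Lemma ideal_point_Cmod (c : C) (r : R) (a : C) : 0 < r -> unit2 a ->
  Cmod (ideal_point c r a - c)%C = r.
Proof.
intros hr Ha. apply Rsqr_inj; [apply Cmod_ge_0 | lra |].
rewrite !Rsqr_pow2, Cmod_sqr.
transitivity (r ^ 2 * (fst a ^ 2 + snd a ^ 2) ^ 2).
- unfold ideal_point, pole1, pole2. simpl. ring.
- rewrite Ha. ring.
Qed.

(** Sum-to-product formulas: the chord is directed along the vector [(pole1, pole2)] turned by a
    right angle. *)
Lemma ideal_point_sub (c : C) (r : R) (a b : C) : unit2 a -> unit2 b ->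
  fst (ideal_point c r b) - fst (ideal_point c r a) = - (2 * det2 a b * pole2 r a b)
  /\ snd (ideal_point c r b) - snd (ideal_point c r a) = 2 * det2 a b * pole1 r a b.
Proof.
unfold unit2, ideal_point, det2, pole1, pole2.
destruct a as [a1 a2], b as [b1 b2]; cbn [fst snd]. intros Ha Hb. split.
- transitivity (r * ((b1 ^ 2 - b2 ^ 2) * 1 - (a1 ^ 2 - a2 ^ 2) * 1)); [ring |].
  rewrite <- Ha at 1. rewrite <- Hb. ring.
- transitivity (2 * r * (b1 * b2 * 1 - a1 * a2 * 1)); [ring |].
  rewrite <- Ha at 1. rewrite <- Hb. ring.
Qed.

(** The chord is the polar of its pole: the equation holds at the endpoint [a], and the direction of
    the chord is perpendicular to the pole vector. *)
Lemma chord_pole (c : C) (r : R) (a b : C) : unit2 a -> unit2 b -> forall s : R,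
  let X := (ideal_point c r a + s * (ideal_point c r b - ideal_point c r a))%C in
  (fst X - fst c) * pole1 r a b + (snd X - snd c) * pole2 r a b = r ^ 2 * pole3 a b.
Proof.
intros Ha Hb s X.
destruct (ideal_point_sub c r a b Ha Hb) as [E1 E2].
assert (E3 : fst X - fst c = pole1 r a a - s * (2 * det2 a b * pole2 r a b)).
{ transitivity (pole1 r a a + s * (fst (ideal_point c r b) - fst (ideal_point c r a)));
    [unfold X; simpl; ring | rewrite E1; ring]. }
assert (E4 : snd X - snd c = pole2 r a a + s * (2 * det2 a b * pole1 r a b)).
{ transitivity (pole2 r a a + s * (snd (ideal_point c r b) - snd (ideal_point c r a)));
    [unfold X; simpl; ring | rewrite E2; ring]. }
rewrite E3, E4. unfold unit2 in Ha.
transitivity (pole1 r a a * pole1 r a b + pole2 r a a * pole2 r a b); [ring |].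
transitivity (r ^ 2 * ((fst a ^ 2 + snd a ^ 2) * pole3 a b)).
- unfold pole1, pole2, pole3. ring.
- rewrite Ha. ring.
Qed.

(** * Orthogonality as incidence with poles *)

(** At the foot [X], the metric pairing of the two directions is a nonzero multiple of the
    determinant expressing incidence with the pole. *)
Lemma orthogonal_pole (c : C) (r : R) (l : C -> Prop) (U V a b : C) :
  0 < r -> unit2 a -> unit2 b -> det2 a b <> 0 ->
  disk c r U -> disk c r V -> U <> V ->
  (forall X : C, l X <-> disk c r X /\ on_line U V X) ->
  orthogonal c r l (ideal_line c r (ideal_point c r a) (ideal_point c r b)) ->
  collinear c U V (pole1 r a b) (pole2 r a b) (pole3 a b).
Proof.
intros hr Ha Hb Hab HU HV HUV Hl [X [HlX [[HX [s Es]] Horth]]].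
assert (HlX' := HlX). apply Hl in HlX' as [_ HX']. destruct HX' as [t Et].
set (A := ideal_point c r a) in *. set (B := ideal_point c r b) in *.
assert (HA : Cmod (A - c)%C = r) by now apply ideal_point_Cmod.
assert (HY : exists (Y : C) (k : R), l Y /\ k <> 0 /\ (Y - X = k * (V - U))%C).
{ destruct (Req_dec t 0) as [-> | Ht].
  - exists V, 1. split; [| split; [lra |]].
    + apply Hl. split; [assumption |]. exists 1. ring.
    + rewrite Et. ring.
  - exists U, (- t). split; [| split; [lra |]].
    + apply Hl. split; [assumption |]. exists 0. ring.
    + rewrite Et, RtoC_opp. ring. }
destruct HY as [Y [k [HlY [Hk EY]]]].
assert (Hs : s <> 0).
{ intros ->. unfold disk in HX. rewrite Es in HX.
  replace (A + 0 * (B - A) - c)%C with (A - c)%C in HX by ring. lra. }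
(* [A] is not in the open disk, so the midpoint of [X] and [A] serves as the second point of the
   chord. *)
pose (Z := ((RtoC (/ 2)) * (X + A))%C).
assert (EZ : (Z - X = RtoC (- s / 2) * (B - A))%C).
{ unfold Z. rewrite Es at 2. rewrite Es at 1.
  destruct A, B; unfold Cminus, Cplus, Cmult, Copp; simpl. f_equal; field. }
assert (HZ : ideal_line c r A B Z).
{ split.
  - unfold disk in *.
    replace (Z - c)%C with (RtoC (/ 2) * (X - c) + RtoC (/ 2) * (A - c))%C
      by (unfold Z; destruct X, A, c; unfold Cminus, Cplus, Cmult, Copp; simpl;
          f_equal; field).
    eapply Rle_lt_trans; [apply Cmod_triangle |].
    rewrite !Cmod_scal, Rabs_pos_eq by lra. lra.
  - exists (s / 2). unfold Z. rewrite Es.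
    destruct A, B; unfold Cminus, Cplus, Cmult, Copp; simpl. f_equal; field. }
specialize (Horth Y Z HlY HZ).
rewrite hinnerE in Horth by assumption.
pose proof (disk_sqr _ _ _ HX) as HX2.
apply Rmult_integral in Horth. destruct Horth as [Horth | Horth].
2: { exfalso. revert Horth. apply Rinv_neq_0_compat, pow_nonzero. lra. }
rewrite EY, EZ in Horth. rewrite Cmod_sqr in Horth. clear HX2 EY EZ HZ.
pose proof (ideal_point_sub c r a b Ha Hb) as [EBA1 EBA2].
pose proof (chord_pole c r a b Ha Hb s) as Hchord. fold A B in EBA1, EBA2, Hchord.
rewrite <- Es in Hchord. cbv zeta in Hchord.
unfold collinear.
transitivity
  (det3 (fst X - fst c) (snd X - snd c) 1 (fst V - fst U) (snd V - snd U) 0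
        (pole1 r a b) (pole2 r a b) (pole3 a b)).
{ rewrite Et. unfold det3. destruct U, V, c; simpl. ring. }
apply Rmult_eq_reg_l with (r ^ 2 * (k * s * det2 a b)).
2: { repeat apply Rmult_integral_contrapositive_currified; auto; lra. }
rewrite Rmult_0_r. refine (eq_trans _ Horth).
clear - Hchord EBA1 EBA2.
unfold det3.
(* Isolating [r ^ 2 * pole3 a b] lets [Hchord] trade it for the product of [X - c] with the pole
   vector. *)
transitivity
  (k * s * det2 a b *
   (((fst X - fst c) * (snd V - snd U) - (snd X - snd c) * (fst V - fst U))
      * (r ^ 2 * pole3 a b)
    + r ^ 2 * ((fst V - fst U) * pole2 r a b - (snd V - snd U) * pole1 r a b)));
  [ring |].
rewrite <- Hchord.
destruct X as [x y], U as [u1 u2], V as [v1 v2], c as [c1 c2], A as [A1 A2], B as [B1 B2].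
unfold dot; simpl in *.
replace B1 with (A1 - 2 * det2 a b * pole2 r a b) by lra.
replace B2 with (A2 + 2 * det2 a b * pole1 r a b) by lra.
field.
Qed.

(* Cramer's rule: a line through the points s and s' is given, up to a factor,
   by the linear form det (s, s', _). *)
Lemma incident_det3 (m1 m2 m3 s1 s2 s3 t1 t2 t3 w1 w2 w3 x y z : R) :
  m1 <> 0 \/ m2 <> 0 ->
  m1 * s1 + m2 * s2 + m3 * s3 = 0 -> m1 * t1 + m2 * t2 + m3 * t3 = 0 ->
  det3 s1 s2 s3 t1 t2 t3 w1 w2 w3 <> 0 ->
  m1 * x + m2 * y + m3 * z = 0 <-> det3 s1 s2 s3 t1 t2 t3 x y z = 0.
Proof.
intros Hm Hs Ht HD.
assert (Cramer : forall x y z,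
  det3 s1 s2 s3 t1 t2 t3 w1 w2 w3 * (m1 * x + m2 * y + m3 * z) =
  (m1 * w1 + m2 * w2 + m3 * w3) * det3 s1 s2 s3 t1 t2 t3 x y z).
{ clear x y z. intros x y z.
  (* The form [m] is applied to the expansion of [(x, y, z)] in the basis [s, t, w], cleared of its
     denominator. *)
  transitivity (det3 x y z t1 t2 t3 w1 w2 w3 * (m1 * s1 + m2 * s2 + m3 * s3)
    + det3 s1 s2 s3 x y z w1 w2 w3 * (m1 * t1 + m2 * t2 + m3 * t3)
    + (m1 * w1 + m2 * w2 + m3 * w3) * det3 s1 s2 s3 t1 t2 t3 x y z).
  - unfold det3. ring.
  - rewrite Hs, Ht. ring. }
assert (Hw : m1 * w1 + m2 * w2 + m3 * w3 <> 0).
{ intros E. rewrite E in Cramer.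
  pose proof (Cramer 1 0 0) as C1. pose proof (Cramer 0 1 0) as C2.
  rewrite Rmult_0_l in C1, C2.
  apply Rmult_integral in C1, C2. destruct Hm; lra. }
specialize (Cramer x y z). split; intros E; rewrite E, Rmult_0_r in Cramer.
- symmetry in Cramer. apply Rmult_integral in Cramer. tauto.
- apply Rmult_integral in Cramer. tauto.
Qed.

(** * Offsets and common perpendiculars *)

(* Up to a factor depending only on [P], the signed hyperbolic sine of the
   distance from [P] to the oriented chord from [A] to [B]. *)
Definition offset (P A B : C) : R :=
  det2 (A - P)%C (B - P)%C / Cmod (A - B)%C ^ 2.

Lemma offset_reverse (P A B : C) : offset P B A = - offset P A B.
Proof.
unfold offset. rewrite (Cmod_sqr (A - B)%C), (Cmod_sqr (B - A)%C).
replace (fst (B - A)%C ^ 2 + snd (B - A)%C ^ 2)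
  with (fst (A - B)%C ^ 2 + snd (A - B)%C ^ 2) by (simpl; ring).
unfold det2, Rdiv. ring.
Qed.

Definition chord (c : C) (r : R) (a b P : C) : R :=
  pole1 r a b * (fst P - fst c) + pole2 r a b * (snd P - snd c)
  - r ^ 2 * pole3 a b.

(** [chord] and [det2] both change sign with [a], so their quotient depends only on the ideal
    points. *)
Lemma offset_ideal_point (c : C) (r : R) (a b P : C) :
  0 < r -> unit2 a -> unit2 b -> det2 a b <> 0 ->
  offset P (ideal_point c r a) (ideal_point c r b) =
  - chord c r a b P / (2 * r ^ 2 * det2 a b).
Proof.
intros hr Ha Hb Hab.
destruct (ideal_point_sub c r a b Ha Hb) as [E1 E2].
pose proof (chord_pole c r a b Ha Hb 0) as E3. cbv zeta in E3.
replace (ideal_point c r a + _)%C with (ideal_point c r a) in E3 by ring.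
unfold offset. rewrite Cmod_sqr.
set (A := ideal_point c r a) in *. set (B := ideal_point c r b) in *.
replace (fst (A - B)%C ^ 2 + snd (A - B)%C ^ 2)
  with ((fst B - fst A) ^ 2 + (snd B - snd A) ^ 2) by (simpl; ring).
replace (det2 (A - P)%C (B - P)%C) with (- (2 * det2 a b) * chord c r a b P).
- rewrite E1, E2.
  replace ((- (2 * det2 a b * pole2 r a b)) ^ 2 + (2 * det2 a b * pole1 r a b) ^ 2)
    with (4 * det2 a b ^ 2 * r ^ 2).
  + field. lra.
  + transitivity (4 * det2 a b ^ 2 * r ^ 2
      * ((fst a ^ 2 + snd a ^ 2) * (fst b ^ 2 + snd b ^ 2))).
    * rewrite Ha, Hb. ring.
    * unfold pole1, pole2. ring.
- unfold chord. rewrite <- E3.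
  transitivity ((fst A - fst P) * (2 * det2 a b * pole1 r a b)
    - (snd A - snd P) * - (2 * det2 a b * pole2 r a b)); [ring |].
  rewrite <- E1, <- E2. unfold det2. simpl. ring.
Qed.

(** The line joining the poles of [a b] and [a' b'] lies in the pencil of the diagonals [a a'] and
    [b b']. Dividing by [det2 a a' * det2 b b'] leaves [2 * r ^ 2] times the sum of their
    offsets. *)
Lemma det3_poles (c : C) (r : R) (a b a' b' P : C) :
  det3 (pole1 r a b) (pole2 r a b) (pole3 a b)
       (pole1 r a' b') (pole2 r a' b') (pole3 a' b')
       (fst P - fst c) (snd P - snd c) 1 =
  - (det2 b b' * chord c r a a' P + det2 a a' * chord c r b b' P).
Proof.
unfold det3, chord, det2, pole1, pole2, pole3. ring.
Qed.

(** Both poles lie on [l] by [orthogonal_pole], so [l] is the line joining them and [det3_poles]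
    gives its equation. *)
Lemma common_perpendicular_offset (c : C) (r : R) (l : C -> Prop)
  (a b a' b' P : C) :
  0 < r -> unit2 a -> unit2 b -> unit2 a' -> unit2 b' ->
  common_perpendicular c r
    (ideal_line c r (ideal_point c r a) (ideal_point c r b))
    (ideal_line c r (ideal_point c r a') (ideal_point c r b')) l ->
  disk c r P ->
  det2 a b <> 0 -> det2 a' b' <> 0 -> det2 a a' <> 0 -> det2 b b' <> 0 ->
  det2 a b' <> 0 -> det2 b a' <> 0 ->
  l P <->
  offset P (ideal_point c r a) (ideal_point c r a')
  + offset P (ideal_point c r b) (ideal_point c r b') = 0.
Proof.
intros hr Ha Hb Ha' Hb' [[U [V [HU [HV [HUV Hl]]]]] [Ho Ho']] HP
  Hab Hab' Haa Hbb Hab2 Hba.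
pose proof (orthogonal_pole c r l U V a b hr Ha Hb Hab HU HV HUV Hl Ho) as H1.
pose proof (orthogonal_pole c r l U V a' b' hr Ha' Hb' Hab' HU HV HUV Hl Ho') as H2.
rewrite !offset_ideal_point by assumption.
transitivity (collinear c U V (fst P - fst c) (snd P - snd c) 1).
{ rewrite Hl, (on_line_collinear c U V P HUV). tauto. }
pose (m1 := snd U - snd V). pose (m2 := fst V - fst U).
pose (m3 := (fst U - fst c) * (snd V - snd c) - (snd U - snd c) * (fst V - fst c)).
assert (EM : forall x y z, collinear c U V x y z <-> m1 * x + m2 * y + m3 * z = 0).
{ intros x y z. unfold collinear.
  replace (det3 _ _ _ _ _ _ x y z) with (m1 * x + m2 * y + m3 * z)
    by (unfold det3, m1, m2, m3; ring).
  reflexivity. }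
apply EM in H1, H2. rewrite EM.
assert (Hm : m1 <> 0 \/ m2 <> 0).
{ destruct (Req_dec m1 0) as [E1 |]; [right; intros E2 | now left].
  apply HUV. unfold m1, m2 in *. apply injective_projections; lra. }
(* The pole of [a a'] serves as a point off that line: the determinant factors into three nonzero
   [det2]. *)
assert (HD : det3 (pole1 r a b) (pole2 r a b) (pole3 a b)
                  (pole1 r a' b') (pole2 r a' b') (pole3 a' b')
                  (pole1 r a a') (pole2 r a a') (pole3 a a') <> 0).
{ replace (det3 _ _ _ _ _ _ _ _ _)
    with (- 2 * r ^ 2 * (det2 a a' * det2 a b' * det2 b a'))
    by (unfold det3, det2, pole1, pole2, pole3; ring).
  repeat apply Rmult_integral_contrapositive_currified; auto; lra. }
rewrite (incident_det3 _ _ _ _ _ _ _ _ _ _ _ _ _ _ _ Hm H1 H2 HD).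
rewrite det3_poles.
transitivity
  (- (chord c r a a' P / det2 a a' + chord c r b b' P / det2 b b') = 0).
- split; intros E.
  + apply Rmult_eq_reg_l with (det2 a a' * det2 b b');
      [| now apply Rmult_integral_contrapositive].
    rewrite Rmult_0_r, <- E. field. tauto.
  + replace 0 with (det2 a a' * det2 b b' * 0) by ring.
    rewrite <- E. field. tauto.
- split; intros E.
  + apply Rmult_eq_reg_l with (2 * r ^ 2); [| nra].
    rewrite Rmult_0_r, <- E. field. repeat split; auto; lra.
  + replace 0 with (2 * r ^ 2 * 0) by ring.
    rewrite <- E. field. repeat split; auto; lra.
Qed.

(** * Going round the polygon *)

(** Two polar angles differ by a nonzero amount below [2 * PI], so half the difference has nonzero
    sine. Indices stay in [1..m], as [theta] is unconstrained beyond. *)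
Lemma ideal_polygon_half_angles (c : C) (r : R) (m : nat) (A : nat -> C) :
  ideal_polygon c r m A ->
  exists a : nat -> C,
    (forall k, unit2 (a k)) /\
    (forall k, (1 <= k <= m)%nat -> A k = ideal_point c r (a k)) /\
    (forall j k, (1 <= j <= m)%nat -> (1 <= k <= m)%nat -> j <> k ->
       det2 (a j) (a k) <> 0).
Proof.
intros [_ [theta [HA [Hmono Hturn]]]].
exists (fun k => (cos (theta k / 2), sin (theta k / 2))). split; [| split].
- intros k. unfold unit2; cbn [fst snd].
  pose proof (sin2_cos2 (theta k / 2)) as E. rewrite !Rsqr_pow2 in E. lra.
- intros k Hk. rewrite HA by assumption.
  replace (theta k) with (2 * (theta k / 2)) at 1 2 by field.
  rewrite cos_2a, sin_2a.
  unfold ideal_point, pole1, pole2, Cplus, Cmult; simpl. f_equal; ring.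
- assert (Hlt : forall j k, (1 <= j < k)%nat -> (k <= m)%nat ->
    sin (theta k / 2 - theta j / 2) <> 0).
  { intros j k Hj Hk.
    assert (Hjk : theta j <> theta k) by
      (destruct Hmono as [H | H]; specialize (H j k Hj Hk); lra).
    assert (Hr : Rabs (theta k - theta j) <= Rabs (theta m - theta 1%nat)).
    { assert (E1 : (j = 1 \/ 1 < j)%nat) by lia.
      assert (E2 : (k = m \/ k < m)%nat) by lia.
      destruct Hmono as [H | H]; pose proof (H j k Hj Hk);
        pose proof (H 1%nat m ltac:(lia) ltac:(lia)).
      - assert (theta 1%nat <= theta j) by
          (destruct E1 as [-> | E1]; [lra |];
           pose proof (H 1%nat j ltac:(lia) ltac:(lia)); lra).
        assert (theta k <= theta m) by
          (destruct E2 as [-> | E2]; [lra |];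
           pose proof (H k m ltac:(lia) ltac:(lia)); lra).
        rewrite !Rabs_pos_eq; lra.
      - assert (theta j <= theta 1%nat) by
          (destruct E1 as [-> | E1]; [lra |];
           pose proof (H 1%nat j ltac:(lia) ltac:(lia)); lra).
        assert (theta m <= theta k) by
          (destruct E2 as [-> | E2]; [lra |];
           pose proof (H k m ltac:(lia) ltac:(lia)); lra).
        rewrite !Rabs_left; lra. }
    destruct (Rtotal_order (theta j) (theta k)) as [H | [H | H]]; [| easy |].
    - rewrite Rabs_pos_eq in Hr by lra.
      apply Rgt_not_eq, sin_gt_0; lra.
    - rewrite Rabs_left in Hr by lra.
      replace (theta k / 2 - theta j / 2) with (- ((theta j - theta k) / 2)) by field.
      rewrite sin_neg. apply Rlt_not_eq.
      pose proof (sin_gt_0 ((theta j - theta k) / 2) ltac:(lra) ltac:(lra)). lra. }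
  intros j k Hj Hk Hne E. unfold det2 in E; cbn [fst snd] in E.
  destruct (Nat.lt_gt_cases j k) as [H _]. destruct (H Hne) as [Hl | Hl].
  + apply (Hlt j k ltac:(lia) ltac:(lia)). rewrite sin_minus. lra.
  + apply (Hlt k j ltac:(lia) ltac:(lia)). rewrite sin_minus. lra.
Qed.

Theorem proposition6
  (c : C) (r : R) (hr : 0 < r)
  (n : nat) (hn : (1 <= n)%nat)
  (A : nat -> C) (hA : ideal_polygon c r (4 * n + 2) A)
  (l : nat -> C -> Prop)
  (hl : forall i : nat, (1 <= i <= 2 * n + 1)%nat ->
     common_perpendicular c r
       (ideal_line c r (A i) (A (i + 1)%nat))
       (ideal_line c r (A (i + 2 * n + 1)%nat) (A (i + 2 * n + 2)%nat))
       (l i))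
  (P : C) (hP : disk c r P)
  (hconc : forall i : nat, (1 <= i <= 2 * n)%nat -> l i P) :
  l (2 * n + 1)%nat P.
Proof.
pose proof (ideal_polygon_half_angles c r _ A hA) as [a [Hu [HA Hdet]]].
set (off := fun i => offset P (A i) (A (i + 2 * n + 1)%nat)).
assert (Hstep : forall i, (1 <= i <= 2 * n)%nat -> off (i + 1)%nat = - off i).
{ intros i Hi. unfold off.
  replace (i + 1 + 2 * n + 1)%nat with (i + 2 * n + 2)%nat by lia.
  (* For [i <= 2n] all four vertex indices stay within [4n + 2], so [HA] and [Hdet] apply without
     wrapping around. *)
  pose proof (hconc i Hi) as HlP. revert HlP. specialize (hl i ltac:(lia)).
  revert hl. rewrite !HA by lia. intros hl HlP.
  rewrite (common_perpendicular_offset c r (l i) _ _ _ _ P hr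
    (Hu _) (Hu _) (Hu _) (Hu _) hl hP) in HlP by (apply Hdet; lia).
  lra. }
(* Two steps cancel the sign, and the [2n] steps from [off 1] to [off (2n + 1)] are even in
   number. *)
assert (Hpar : forall k, (k <= n)%nat -> off (2 * k + 1)%nat = off 1%nat).
{ induction k as [| k IH]; intros Hk; [reflexivity |].
  replace (2 * S k + 1)%nat with (2 * k + 1 + 1 + 1)%nat by lia.
  rewrite !Hstep, IH by lia. ring. }
specialize (Hpar n (le_n n)). unfold off in Hpar.
specialize (hl (2 * n + 1)%nat ltac:(lia)). revert hl Hpar.
(* The last side ends at [A (4n + 3)], which periodicity turns into [A 1]; the second diagonal, from
   [A (2n + 2)] to [A 1], is then the first one reversed. *)
replace (2 * n + 1 + 2 * n + 2)%nat with (1 + (4 * n + 2))%nat by lia.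
replace (2 * n + 1 + 2 * n + 1)%nat with (4 * n + 2)%nat by lia.
rewrite (proj1 hA 1%nat).
replace (1 + 2 * n + 1)%nat with (2 * n + 2)%nat by lia.
replace (2 * n + 1 + 1)%nat with (2 * n + 2)%nat by lia.
rewrite !HA by lia. intros hl Hpar.
rewrite (common_perpendicular_offset c r _ _ _ _ _ P hr
  (Hu _) (Hu _) (Hu _) (Hu _) hl hP) by (apply Hdet; lia).
rewrite Hpar, (offset_reverse P (ideal_point c r (a 1%nat))). ring.
Qed.
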